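(* Let $P$ be a vertically degenerate 0-1 matrix with at least one 1-entry. Then $\mathrm{ex}(n,P)\le n^{1+o(1)}$, i.e., there is a function $\varepsilon(n)\to 0$ as $n\to\infty$ such that $\mathrm{ex}(n,P)\le n^{1+\varepsilon(n)}$ for all $n$.
   Context: A 0-1 matrix $A$ contains a 0-1 matrix $B$ (written $B\prec A$) if $B$ can be obtained from $A$ by deleting some rows, some columns, and changing some 1-entries to 0-entries. The weight $w(A)$ is the number of 1-entries of $A$. For a 0-1 matrix $P$ (a ''pattern'') with at least one 1-entry, $\mathrm{ex}(n,P)$ is the maximum weight of an $n\times n$ 0-1 matrix that does not contain $P$. An $l\times k$ 0-1 matrix $P$ is vertically separable if there exists $1\le a<l$ such that for all but at most one column $y\in[k]$, either $P(x,y)=0$ for every $x\le a$ or $P(x,y)=0$ for every $x>a$. A 0-1 matrix $P$ is vertically degenerate if every submatrix of $P$ (formed by a subset of rows and a subset of columns) either has a single row or is vertically separable. *)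

(* Defs.v *)
From mathcomp Require Import all_boot all_order all_algebra.

Set Implicit Arguments.
Unset Strict Implicit.
Unset Printing Implicit Defensive.

(* 0-1 matrices are boolean matrices ['M[bool]_(l, k)]; indices start at 0. *)

Definition increasing (l m : nat) (f : 'I_l -> 'I_m) : bool :=
  [forall i : 'I_l, forall j : 'I_l, (i < j) ==> (f i < f j)].

(* A choice of l rows of [A] is encoded by the strictly increasing map
   enumerating it, and similarly for columns. *)
Definition submatrix (l k m n : nat)
    (B : 'M[bool]_(l, k)) (A : 'M[bool]_(m, n)) : bool :=
  [exists f : {ffun 'I_l -> 'I_m}, exists g : {ffun 'I_k -> 'I_n},
    [&& increasing f, increasing g & B == mxsub f g A]].

Definition contains (l k m n : nat)
    (A : 'M[bool]_(m, n)) (B : 'M[bool]_(l, k)) : bool :=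
  [exists A' : 'M[bool]_(l, k),
    submatrix A' A && [forall i, forall j, B i j ==> A' i j]].

Definition weight (m n : nat) (A : 'M[bool]_(m, n)) : nat :=
  #|[set ij : 'I_m * 'I_n | A ij.1 ij.2]|.

(* When [P] has a 1-entry the zero matrix avoids [P], so the maximum ranges
   over a nonempty family. *)
Definition extremal (n l k : nat) (P : 'M[bool]_(l, k)) : nat :=
  \max_(A : 'M[bool]_n | ~~ contains A P) weight A.

(* With indices starting at 0, the first [a] rows are those with [x < a]. *)
Definition vertically_separable (l k : nat) (P : 'M[bool]_(l, k)) : Prop :=
  exists a : nat, (1 <= a < l) /\
    #|[set y : 'I_k | ~~ ([forall x : 'I_l, (x < a) ==> ~~ P x y]
                       || [forall x : 'I_l, (a <= x) ==> ~~ P x y])]| <= 1.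

(* Submatrices are nonempty: one without rows could satisfy neither
   alternative. *)
Definition vertically_degenerate (l k : nat) (P : 'M[bool]_(l, k)) : Prop :=
  forall (l' k' : nat) (Q : 'M[bool]_(l', k')),
    0 < l' -> 0 < k' -> submatrix Q P ->
    l' = 1 \/ vertically_separable Q.

(* Main.v *)
Require Import Defs.
From mathcomp Require Import all_boot all_order all_algebra.
From mathcomp Require Import zify boolp.

Set Implicit Arguments.
Unset Strict Implicit.
Unset Printing Implicit Defensive.

(** Fix e > 0 and suppose that a P-free n x n matrix of weight W = ex(n, P)
violates ex(n, P) <= C n^(1+e) with n minimal.  Then at every constant scale s
all (n/s) x (n/s) submatrices are sparse: they have weight at most W / (L s),
where L is large if s is.  Cut the columns into s consecutive chunks of length
about n/s.  By sparseness the 1-entries of a typical row cannot be concentrated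
in a bounded number of chunks, and W cannot be carried by few rows; so for each
q a constant proportion of the rows are rich (have at least W / O(n) 1-entries)
in the same q chunks.  The same holds with rows and columns exchanged.

First find many rows that are all rich in k common column chunks C_1 < ... < C_k,
then look for a copy of P with its y-th column in C_y, by induction on the number
of rows of P.  Split P into a top and a bottom part sharing at most the column y0.
Branching of the columns of C_y0 over row chunks gives two row chunks, one above
the other, and many columns rich in both.  By induction more than half of these
columns can play the role of y0 in a copy of the top part inside the first row
chunk (otherwise discard them all and find one more), and likewise for the bottom
part; a column with both properties glues two copies together. *)

(** * Sparse relations and their chunks *)

Definition deg (n : nat) (E : rel 'I_n) (r : 'I_n) (Y : {set 'I_n}) : nat :=
  \sum_(c in Y) E r c.

Definition wt (n : nat) (E : rel 'I_n) (X Y : {set 'I_n}) : nat :=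
  \sum_(r in X) deg E r Y.

Definition transp (n : nat) (E : rel 'I_n) : rel 'I_n := fun r c => E c r.

(* Submatrices need not be contiguous.  The pair (s, L) is used with W the weight
   of the host matrix, [s] a large constant and [L] a factor gained at scale [s]. *)
Definition sparse (n : nat) (E : rel 'I_n) (W s L : nat) : Prop :=
  forall X Y : {set 'I_n}, #|X| <= (n %/ s).+1 -> #|Y| <= (n %/ s).+1 ->
    L * s * wt E X Y <= W.

(** The width [(n %/ s).+1] is the side length that [sparse] allows, and [s] chunks of it cover all
    indices. *)
Definition chunk (n s i : nat) : {set 'I_n} :=
  [set c : 'I_n | c %/ (n %/ s).+1 == i].

Lemma leq_sum_subset (I : finType) (X Y : {set I}) (F : I -> nat) :
  X \subset Y -> \sum_(i in X) F i <= \sum_(i in Y) F i.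
Proof.
move=> sXY; rewrite [leqRHS](big_setID X) /= (setIidPr sXY); exact: leq_addr.
Qed.

Section Sparse.
Context (n : nat).
Implicit Types (E : rel 'I_n) (X Y : {set 'I_n}).

Lemma deg_subset E r Y1 Y2 : Y1 \subset Y2 -> deg E r Y1 <= deg E r Y2.
Proof. exact: leq_sum_subset. Qed.

Lemma deg_gt0 E r Y : 0 < deg E r Y -> exists2 c, c \in Y & E r c.
Proof.
rewrite lt0n sum_nat_eq0 negb_forall => /existsP[c].
by rewrite negb_imply eqb0 negbK => /andP[]; exists c.
Qed.

Lemma wt_transp E X Y : wt (transp E) Y X = wt E X Y.
Proof. by rewrite /wt /deg exchange_big. Qed.

Lemma wt_subset E X1 X2 Y1 Y2 :
  X1 \subset X2 -> Y1 \subset Y2 -> wt E X1 Y1 <= wt E X2 Y2.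
Proof.
move=> sX sY; apply: leq_trans (leq_sum_subset _ sX).
by apply: leq_sum => r _; apply: deg_subset.
Qed.

Lemma wt_setID E X Y Y' : wt E X Y = wt E X (Y :&: Y') + wt E X (Y :\: Y').
Proof.
rewrite /wt -big_split /=; apply: eq_bigr => r _.
by rewrite /deg (big_setID Y').
Qed.

Lemma sparse_transp E W s L : sparse E W s L -> sparse (transp E) W s L.
Proof. by move=> spE X Y hX hY; rewrite wt_transp; apply: spE. Qed.

Lemma chunk_lt s (c : 'I_n) : 0 < s -> c %/ (n %/ s).+1 < s.
Proof.
move=> s0; rewrite ltn_divLR // (leq_trans (ltn_ord c)) // ltnW //.
by rewrite mulnC; apply: ltn_ceil.
Qed.

Lemma leq_ceil s : 0 < s -> n <= s * (n %/ s).+1.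
Proof. by move=> s0; rewrite mulnC ltnW // ltn_ceil. Qed.

Lemma card_chunk s i : #|chunk n s i| <= (n %/ s).+1.
Proof.
set h := (n %/ s).+1.
have <- : #|[set (inord (val c %% h) : 'I_h) | c in chunk n s i]| = #|chunk n s i|.
  apply: card_in_imset => c d; rewrite !inE => /eqP hc /eqP hd.
  move/(congr1 val); rewrite /= !inordK ?ltn_mod // => e.
  by apply: val_inj; rewrite /= (divn_eq c h) (divn_eq d h) hc hd e.
by rewrite (leq_trans (max_card _)) // card_ord.
Qed.

(** [Y] is cut into pieces of size [(n %/ s).+1]; the term added to [#|Y|] pays for the last,
    incomplete piece. *)
Lemma sparse_wide E W s L X Y :
  sparse E W s L -> #|X| <= (n %/ s).+1 ->
  (n %/ s).+1 * (L * s * wt E X Y) <= (#|Y| + (n %/ s).+1) * W.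
Proof.
move=> spE hX; move: {2}#|Y| (leqnn #|Y|) => N.
have small (Z : {set 'I_n}) : #|Z| <= (n %/ s).+1 ->
    (n %/ s).+1 * (L * s * wt E X Z) <= (#|Z| + (n %/ s).+1) * W.
  by move=> hZ; rewrite leq_mul ?leq_addl //; apply: spE.
elim: N Y => [|N IHN] Y hN; first by apply: small; lia.
have [/small //|] := leqP #|Y| (n %/ s).+1.
move: small hX; set h := (n %/ s).+1 => small hX hY.
have [Y' /[!inE] /andP[sY' /eqP cY']] : exists Y' : {set 'I_n},
    Y' \in [set Z : {set 'I_n} | (Z \subset Y) && (#|Z| == h)].
  by apply/card_gt0P; rewrite cards_draws bin_gt0 ltnW.
have cD : #|Y :\: Y'| = #|Y| - h by rewrite cardsD (setIidPr sY') cY'.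
have h1 := spE X Y' hX (eq_leq cY').
have /IHN : #|Y :\: Y'| <= N.
  by rewrite cD leq_subLR (leq_trans hN) // addnC -addn1 leq_add2l.
rewrite cD subnK ?(ltnW hY) // (wt_setID E X Y Y') (setIidPr sY').
rewrite !mulnDr mulnDl => h2; rewrite addnC leq_add // leq_mul2l h1 orbT //.
Qed.

Lemma sparse_narrow E W s L X Y :
  0 < s -> sparse E W s L -> #|X| <= (n %/ s).+1 -> L * wt E X Y <= 2 * W.
Proof.
move=> s0 spE hX; have := sparse_wide Y spE hX.
have cY : #|Y| <= n by rewrite (leq_trans (max_card _)) // card_ord.
have := leq_ceil s0; set h := (n %/ s).+1; set w := wt _ _ _ => hn H.
have h0 : 0 < h * s by rewrite muln_gt0 s0.
rewrite -(leq_pmul2l h0); apply: (@leq_trans ((#|Y| + h) * W)); first by nia.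
have : #|Y| + h <= 2 * (s * h) by nia.
nia.
Qed.

(** Each chunk is the small side in [sparse_wide] for the transpose; the [s] rounding terms together
    contribute the extra [W]. *)
Lemma sparse_chunks E W s L b (Z : nat -> {set 'I_n}) :
  0 < s -> sparse E W s L -> \sum_(i < s) #|Z i| <= b * n ->
  L * \sum_(i < s) wt E (Z i) (chunk n s i) <= b.+1 * W.
Proof.
move=> s0 /sparse_transp spE hZ.
have H (i : 'I_s) : (n %/ s).+1 * (L * s * wt E (Z i) (chunk n s i))
    <= (#|Z i| + (n %/ s).+1) * W.
  by rewrite -wt_transp; apply: sparse_wide => //; apply: card_chunk.
have {H} : \sum_(i < s) (n %/ s).+1 * (L * s * wt E (Z i) (chunk n s i))
    <= \sum_(i < s) (#|Z i| + (n %/ s).+1) * W by apply: leq_sum => i _; apply: H.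
rewrite -!big_distrr -!big_distrl /= big_split /= sum_nat_const card_ord.
have := leq_ceil s0; set h := (n %/ s).+1; set S := \sum_(i < s) wt _ _ _.
set T := \sum_(i < s) _ in hZ * => hn H.
have h0 : 0 < h * s by rewrite muln_gt0 s0.
rewrite -(leq_pmul2l h0); apply: (@leq_trans ((T + s * h) * W)); first by nia.
have : T + s * h <= b.+1 * (s * h) by nia.
nia.
Qed.

Lemma deg_chunks E r Y s : 0 < s ->
  deg E r Y = \sum_(i < s) deg E r (Y :&: chunk n s i).
Proof.
move=> s0; rewrite /deg.
rewrite (partition_big (fun c => Ordinal (chunk_lt c s0)) predT) //=.
by apply: eq_bigr => i _; apply: eq_bigl => c; rewrite !inE.
Qed.

Lemma increasing_enum s q (H : {set 'I_s}) : q <= #|H| ->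
  exists2 f : {ffun 'I_q -> 'I_s}, increasing f & forall j, f j \in H.
Proof.
move=> hq; have lt_j (j : 'I_q) : j < #|H| by apply: leq_trans hq.
exists [ffun j => enum_val (Ordinal (lt_j j))]; last first.
  by move=> j; rewrite ffunE enum_valP.
apply/forallP => i; apply/forallP => j; apply/implyP => ij; rewrite !ffunE.
have srt : sorted ltn (map val (enum H)).
  rewrite /enum_mem -enumT sorted_map; apply: sorted_filter => [x y z|].
    exact: ltn_trans.
  by rewrite -sorted_map val_enum_ord iota_ltn_sorted.
have x0 : 'I_s by exact: (enum_val (Ordinal (lt_j i))).
rewrite !(enum_val_nth x0) /= -!(nth_map x0 0 val) -?cardE ?lt_j //.
by apply: (sorted_ltn_nth ltn_trans) => //; rewrite inE size_map -cardE lt_j.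
Qed.

(** Light chunks, and the heavy chunks of rows having fewer than [q] of them, account for weight at
    most [W / (4 * a)] each. The remaining rows carry at least [W / (2 * a)], too much for few rows.
    Pigeonhole on tuples of [q] heavy chunks finishes. *)
Lemma branch E W s a q X Y :
  0 < W -> 0 < s -> 0 < q -> W <= a * wt E X Y -> sparse E W s (4 * a * q.+1) ->
  exists beta : {ffun 'I_q -> 'I_s}, increasing beta /\
  exists R : {set 'I_n}, [/\ R \subset X, n <= 4 * a * s ^ q.+1 * #|R| &
    forall r j, r \in R ->
      W <= 4 * a * s ^ q.+1 * n * deg E r (Y :&: chunk n s (beta j))].
Proof.
move=> W0 s0 q0 hW spE.
have a0 : 0 < a by case: a hW {spE} => // /(leq_trans W0).
have n0 : 0 < n.
  case: (posnP n) => // n0; move: hW; rewrite /wt big1 ?muln0 => [|r _].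
    by move/(leq_trans W0).
  by have := ltn_ord r; rewrite {2}n0.
pose d r (i : 'I_s) := deg E r (Y :&: chunk n s i).
pose heavy r : {set 'I_s} := [set i | W <= 4 * a * s * n * d r i].
pose B := [set r in X | q <= #|heavy r|].
pose N := [set r in X | #|heavy r| < q].
have cX (Z : {set 'I_n}) : #|Z| <= n by rewrite (leq_trans (max_card _)) ?card_ord.
pose light := \sum_(r in X) \sum_(i < s | i \notin heavy r) d r i.
pose narrow := \sum_(r in N) \sum_(i in heavy r) d r i.
(* There are at most [n] rows with [s] chunks each, and a light chunk holds less than
   [W / (4 * a * s * n)]. *)
have hlight : 4 * a * light <= W.
  have : 4 * a * s * n * light <= #|X| * (s * W).
    rewrite -sum_nat_const /light big_distrr; apply: leq_sum => r _ /=.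
    rewrite big_distrr /= -[leqRHS]/(s * W).
    apply: (@leq_trans (\sum_(i < s) W)); last by rewrite sum_nat_const card_ord.
    rewrite big_mkcond; apply: leq_sum => i _; case: ifP => //.
    by rewrite inE -ltnNge => /ltnW.
  have := cX X; have sn0 : 0 < s * n by rewrite muln_gt0 s0.
  rewrite -(leq_pmul2l sn0); nia.
(* The rows of [N] for which chunk [i] is heavy form [Z i]; each row lies in fewer than [q] of these
   sets, so [sparse_chunks] applies with [b = q]. *)
have hnarrow : 4 * a * narrow <= W.
  (* [insub] only extends the family from ['I_s] to [nat]. *)
  pose Z i := if insub i is Some j then [set r in N | j \in heavy r] else set0.
  have ZE (i : 'I_s) : Z i = [set r in N | i \in heavy r] by rewrite /Z valK.
  have hZ : \sum_(i < s) #|Z i| <= q * n.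
    have -> : \sum_(i < s) #|Z i| = \sum_(r in N) #|heavy r|.
      under [LHS]eq_bigr do rewrite ZE -sum1_card.
      under [RHS]eq_bigr do rewrite -sum1_card.
      rewrite (exchange_big_dep (mem N)) /=; last first.
        by move=> i r _; rewrite inE => /andP[].
      by apply: eq_bigr => r rN; apply: eq_bigl => i; rewrite inE rN.
    apply: (@leq_trans (\sum_(r in N) q)).
      by apply: leq_sum => r; rewrite inE => /andP[_ /ltnW].
    by rewrite sum_nat_const mulnC leq_mul2l cX orbT.
  have := sparse_chunks s0 spE hZ; set S := \sum_(i < s) _ => hS.
  have narrowS : narrow <= S.
    rewrite /narrow (exchange_big_dep predT) //=; apply: leq_sum => i _.
    rewrite /wt ZE; under [leqRHS]eq_bigl do rewrite in_set.
    by apply: leq_sum => r _; apply: deg_subset; apply: subsetIr.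
  rewrite -(leq_pmul2l (ltn0Sn q)) (leq_trans _ hS) //.
  by rewrite mulnA (mulnC q.+1) leq_mul2l narrowS orbT.
have wt_le : wt E X Y <= light + narrow + wt E B Y.
  rewrite /light.
  have -> : narrow =
      \sum_(r in X) (if r \in N then \sum_(i in heavy r) d r i else 0).
    rewrite -big_mkcondr; apply: eq_bigl => r; by rewrite !inE; case: (r \in X).
  have -> : wt E B Y = \sum_(r in X) (if r \in B then deg E r Y else 0).
    rewrite -big_mkcondr; apply: eq_bigl => r; by rewrite !inE; case: (r \in X).
  rewrite -!big_split; apply: leq_sum => r rX /=.
  rewrite !inE rX /= (deg_chunks E r Y s0); case: leqP => _.
    by rewrite leq_addl.
  by rewrite (bigID (mem (heavy r))) /= addn0 addnC leqnn.
have hB : W <= 2 * a * wt E B Y.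
  have := leq_trans hW (leq_mul (leqnn a) wt_le); rewrite !mulnDr.
  move: hlight hnarrow; rewrite -!mulnA; lia.
(* If [B] were as small as [sparse] allows, [sparse_narrow] would give [q + 1 <= 1]. *)
have cB : n <= s * #|B|.
  have [cB|/ltnW cB] := leqP #|B| (n %/ s).+1; last first.
    by rewrite (leq_trans (leq_ceil s0)) // leq_mul2l cB orbT.
  have h1 := sparse_narrow Y s0 spE cB.
  have : 4 * a * q.+1 * W <= 4 * a * W.
    have := leq_mul (leqnn (2 * a)) h1.
    have := leq_mul (leqnn (4 * a * q.+1)) hB; nia.
  by rewrite leq_pmul2r // -[leqRHS]muln1 leq_pmul2l ?muln_gt0 ?a0 //; lia.
have [r0 r0B] : exists r, r \in B by apply/card_gt0P; lia.
pose ok r (f : {ffun 'I_q -> 'I_s}) := increasing f && [forall j, f j \in heavy r].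
have okP r : r \in B -> exists f, ok r f.
  rewrite inE => /andP[_ /increasing_enum[f inc_f hf]].
  by exists f; rewrite /ok inc_f; apply/forallP.
have [f0 _] := okP _ r0B.
pose choice r := odflt f0 [pick f | ok r f].
have choiceP r : r \in B -> ok r (choice r).
  by move=> /okP[f okf]; rewrite /choice; case: pickP => [//|/(_ f)]; rewrite okf.
(* Pigeonhole over the [s ^ q] maps; the term at [f0] makes the summed inequality strict. *)
have [beta hbeta] : exists f, #|B| <= s ^ q * #|[set r in B | choice r == f]|.
  apply/existsP; apply: contraT; rewrite negb_exists => /forallP H.
  have : s ^ q * #|B| < s ^ q * #|B|; last by rewrite ltnn.
  have {1}-> : #|B| = \sum_f #|[set r in B | choice r == f]|.
    rewrite -sum1_card (partition_big choice predT) //=; apply: eq_bigr => f _.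
    by rewrite -sum1_card; apply: eq_bigl => r; rewrite inE.
  have -> : s ^ q * #|B| = \sum_(f : {ffun 'I_q -> 'I_s}) #|B|.
    by rewrite sum_nat_const card_ffun !card_ord.
  rewrite big_distrr /=; rewrite (bigD1 f0) // [ltnRHS](bigD1 f0) //=.
  rewrite -addSn leq_add //; first by have := H f0; rewrite -ltnNge.
  by apply: leq_sum => f _; have := H f; rewrite -ltnNge => /ltnW.
set R := [set _ in B | _] in hbeta.
have cR : n <= s ^ q.+1 * #|R|.
  by rewrite expnS -mulnA (leq_trans cB) // leq_mul2l hbeta orbT.
have [r1 r1R] : exists r, r \in R by apply/card_gt0P; lia.
have RP r : r \in R -> ok r beta.
  by rewrite inE => /andP[rB /eqP <-]; apply: choiceP.
exists beta; split; first by have /andP[] := RP _ r1R.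
exists R; split; last 2 first.
- nia.
- move=> r j /RP/andP[_ /forallP/(_ j)]; rewrite inE /d => h; apply: (leq_trans h).
  rewrite !leq_mul // expnS; nia.
- by apply/subsetP => r; rewrite !inE => /andP[/andP[]].
Qed.

End Sparse.

(** * Embedding splittable patterns into sparse relations *)

(* Patterns are indexed by [nat] rows so that the induction can run over intervals
   [u, v) of rows, always keeping all [k] columns. *)
Definition splittable (l k : nat) (p : nat -> 'I_k -> bool) : Prop :=
  forall u v, u.+1 < v -> v <= l -> exists m (y0 : 'I_k), u < m < v /\
    forall y, y != y0 -> (forall x, u <= x < m -> ~~ p x y) \/
                         (forall x, m <= x < v -> ~~ p x y).

(** Monotonicity of [g] is left out: in the end the sets [C y] lie in increasing column chunks,
    which orders the columns. *)
Definition embeds (n k : nat) (E : rel 'I_n) (p : nat -> 'I_k -> bool) (u v : nat)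
    (R : {set 'I_n}) (C : 'I_k -> {set 'I_n}) (f : nat -> 'I_n) (g : 'I_k -> 'I_n) :=
  [/\ forall x x', u <= x -> x < x' -> x' < v -> f x < f x',
      forall x, u <= x < v -> f x \in R,
      forall y, g y \in C y &
      forall x y, u <= x < v -> p x y -> E (f x) (g y)].

(* [sigma L] is a scale at which the factor [L] is gained.  The factors needed
   deeper in the recursion depend on the scales chosen before, hence a whole
   function [sigma] and a bound [M] on the finitely many [L] used. *)
Definition sparse_upto (sigma : nat -> nat) (n : nat) (E : rel 'I_n) (W M : nat) :=
  forall L, L <= M -> sparse E W (sigma L) L.

(** Here [1 / a] bounds from below the proportion of rows and, relative to [W / n], their degrees;
    [M] may depend on [a] but not on the host matrix. *)
Definition embeddable (sigma : nat -> nat) (k : nat) (p : nat -> 'I_k -> bool)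
    (u v a M : nat) : Prop :=
  forall n (E : rel 'I_n) W (R : {set 'I_n}) (C : 'I_k -> {set 'I_n}),
    0 < n -> 0 < W -> sparse_upto sigma E W M ->
    n <= a * #|R| -> (forall r y, r \in R -> W <= a * n * deg E r (C y)) ->
    exists f g, embeds E p u v R C f g.

(* The columns that can host column [y0] of a copy of rows [u, v) of [p]. *)
Definition anchors (n k : nat) (E : rel 'I_n) (p : nat -> 'I_k -> bool) (u v : nat)
    (R : {set 'I_n}) (C : 'I_k -> {set 'I_n}) (y0 : 'I_k) : {set 'I_n} :=
  [set c in C y0 | `[< exists f g, embeds E p u v R C f g /\ g y0 = c >] ].

Section Embed.
Context (sigma : nat -> nat) (k : nat) (p : nat -> 'I_k -> bool).
Context (sigma_gt0 : forall L, 0 < sigma L).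

Lemma sparse_upto_le n (E : rel 'I_n) W M M' :
  M <= M' -> sparse_upto sigma E W M' -> sparse_upto sigma E W M.
Proof. by move=> hM sp L hL; apply: sp; apply: leq_trans hM. Qed.

Lemma embeds_sub n (E : rel 'I_n) u v (R R' : {set 'I_n})
    (C C' : 'I_k -> {set 'I_n}) f g :
  R \subset R' -> (forall y, C y \subset C' y) ->
  embeds E p u v R C f g -> embeds E p u v R' C' f g.
Proof.
move=> sR sC [h1 h2 h3 h4]; split=> //.
  by move=> x /h2; apply: (subsetP sR).
by move=> y; apply: (subsetP (sC y)).
Qed.

Lemma wt_lower n (E : rel 'I_n) W a b (X Y : {set 'I_n}) :
  0 < n -> n <= a * #|X| -> (forall r, r \in X -> W <= b * n * deg E r Y) ->
  W <= a * b * wt E X Y.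
Proof.
move=> n0 hX hd; rewrite -(leq_pmul2l n0).
apply: (@leq_trans (a * (#|X| * W))); first by rewrite mulnA leq_mul.
have : #|X| * W <= b * n * wt E X Y.
  by rewrite -sum_nat_const /wt big_distrr; apply: leq_sum => r; apply: hd.
move/(leq_mul (leqnn a)) => /leq_trans; apply.
by rewrite !mulnA (mulnC n) -!mulnA (mulnCA n).
Qed.

Lemma embeddable1 u a : embeddable sigma p u u.+1 a 0.
Proof.
move=> n E W R C n0 W0 _ hR hd.
have [r rR] : exists r, r \in R by apply/card_gt0P; case: #|R| hR => //; lia.
have hg y : exists c, (c \in C y) && E r c.
  have /deg_gt0[c cC Erc] : 0 < deg E r (C y).
    by case: deg (hd r y rR) => //; lia.
  by exists c; rewrite cC.
exists (fun _ => r), (fun y => xchoose (hg y)); split => //.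
- by move=> x x'; lia.
- by move=> y; have /andP[] := xchooseP (hg y).
- by move=> x y _ _; have /andP[] := xchooseP (hg y).
Qed.

Lemma anchors_majority u v a : (forall b, exists M, embeddable sigma p u v b M) ->
  exists M, forall n (E : rel 'I_n) W (R : {set 'I_n}) (C : 'I_k -> {set 'I_n}) y0,
    0 < n -> 0 < W ->
    sparse_upto sigma E W M ->
    (forall r y, r \in R -> y != y0 -> W <= a * n * deg E r (C y)) ->
    n <= a * #|C y0| ->
    (forall c, c \in C y0 -> W <= a * n * deg (transp E) c R) ->
    #|C y0| < 2 * #|anchors E p u v R C y0|.
Proof.
(* [branch] is applied with density constant [2 * a * a], the 2 because half of [C y0] is kept, and
   with [q = 1]; [b] dominates both [a] and the constant it returns. *)
move=> IH; pose L1 := 4 * (2 * a * a) * 2.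
pose b := a + 4 * (2 * a * a) * sigma L1 ^ 2.
have [M hM] := IH b; exists (L1 + M) => n E W R C y0 n0 W0 sp hR hC hc.
rewrite ltnNge; apply/negP => few; set A := anchors _ _ _ _ _ _ _ in few.
pose D := C y0 :\: A.
have sA : A \subset C y0 by apply/subsetP => c; rewrite inE => /andP[].
have cD : #|C y0| <= 2 * #|D|.
  rewrite cardsD (setIidPr sA); have := subset_leq_card sA; lia.
have hW : W <= 2 * a * a * wt E R D.
  rewrite -wt_transp; apply: wt_lower => //; first by nia.
  by move=> c; rewrite inE => /andP[_]; apply: hc.
have [|beta [_ [R' [sR' cR' hR']]]] :=
    @branch n E W (sigma L1) (2 * a * a) 1 R D W0 (sigma_gt0 _) isT hW.
  by apply: sp; rewrite leq_addr.
pose C' y := if y == y0 then D else C y.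
have [||r y rR'|f [g fg]] := hM n E W R' C' n0 W0.
- by apply: sparse_upto_le sp; rewrite leq_addl.
- by rewrite (leq_trans cR') // leq_mul2r /b leq_addl orbT.
- rewrite /C'; case: eqP => [_|/eqP yy0].
    rewrite (leq_trans (hR' r ord0 rR')) // leq_mul //.
      by rewrite leq_mul2r /b leq_addl orbT.
    by apply: deg_subset; apply: subsetIl.
  rewrite (leq_trans (hR r y _ yy0)) ?(subsetP sR') //.
  by rewrite leq_mul2r leq_mul2r /b leq_addr !orbT.
have gD : g y0 \in D by case: fg => _ _ /(_ y0); rewrite /C' eqxx.
have : g y0 \in A.
  have gC : g y0 \in C y0 by move: gD; rewrite inE => /andP[].
  rewrite inE gC; apply/asboolP; exists f, g; split=> //.
  apply: embeds_sub fg => // y; rewrite /C'; case: eqP => // ->.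
  exact: subsetDl.
by move: gD; rewrite inE => /andP[/negPf->].
Qed.

(** Columns with a 1-entry in the upper rows come from [g1], all others from [g2]. Only [y0] can
    have entries in both parts, and there the two copies agree. *)
Lemma embeds_glue n (E : rel 'I_n) u m v (R1 R2 R : {set 'I_n}) C y0 f1 f2 g1 g2 :
  (forall r1 r2, r1 \in R1 -> r2 \in R2 -> r1 < r2) ->
  R1 \subset R -> R2 \subset R ->
  (forall y, y != y0 -> (forall x, u <= x < m -> ~~ p x y) \/
                        (forall x, m <= x < v -> ~~ p x y)) ->
  embeds E p u m R1 C f1 g1 -> embeds E p m v R2 C f2 g2 -> g1 y0 = g2 y0 ->
  exists f g, embeds E p u v R C f g.
Proof.
move=> R12 sR1 sR2 sep [inc1 fR1 gC1 E1] [inc2 fR2 gC2 E2] g12.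
exists (fun x => if x < m then f1 x else f2 x).
exists (fun y => if [exists x : 'I_m, (u <= x) && p x y] then g1 y else g2 y).
split.
- move=> x x' ux xx' x'v; case: (ltnP x m) => xm; case: (ltnP x' m) => x'm.
  + exact: inc1.
  + by apply: R12; [apply: fR1|apply: fR2]; lia.
  + lia.
  + exact: inc2.
- move=> x /andP[ux xv]; case: ltnP => xm.
    by apply: (subsetP sR1); apply: fR1; rewrite ux.
  by apply: (subsetP sR2); apply: fR2; rewrite xm.
- by move=> y; case: ifP.
- move=> x y /andP[ux xv] pxy; case: (ltnP x m) => xm.
    have -> : [exists x : 'I_m, (u <= x) && p x y].
      by apply/existsP; exists (Ordinal xm); rewrite ux.
    by apply: E1; rewrite ?ux.
  have E2xy : E (f2 x) (g2 y) by apply: E2; rewrite ?xm.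
  case: ifP => // /existsP[z /andP[uz pzy]].
  have [e|/sep[] no] := eqVneq y y0; first by rewrite e g12 -e.
    by have := no z; rewrite uz ltn_ord pzy => /(_ isT).
  by have := no x; rewrite xm xv pxy => /(_ isT).
Qed.

Lemma splittable_embeddable l u v a : splittable l p ->
  u < v -> v <= l -> exists M, embeddable sigma p u v a M.
Proof.
move=> spl; move: {2}(v - u) (leqnn (v - u)) => N.
elim: N u v a => [|N IHN] u v a hN uv vl; first by lia.
have [vu|/spl/(_ vl)[m [y0 [/andP[um mv] sep]]]] := leqP v u.+1.
  exists 0; have -> : v = u.+1 by lia.
  exact: embeddable1.
(* [L0] is the factor that [branch] requires for density constant [a * a] and two chunks; [M1] and
   [M2] depend on [sigma L0] through [b]. *)
pose L0 := 4 * (a * a) * 3; pose b := a + 4 * (a * a) * sigma L0 ^ 3.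
have [|M1 hM1] := @anchors_majority u m b.
  by move=> c; apply: IHN; lia.
have [|M2 hM2] := @anchors_majority m v b.
  by move=> c; apply: IHN; lia.
exists (L0 + M1 + M2) => n E W R C n0 W0 sp hR hd.
have hW : W <= a * a * wt (transp E) (C y0) R.
  by rewrite wt_transp; apply: wt_lower => // r; apply: hd.
have [|beta [inc_beta [D [sD cD hD]]]] :=
  @branch n (transp E) W (sigma L0) (a * a) 2 _ _ W0 (sigma_gt0 _) isT hW.
  by apply: sparse_transp; apply: sp; rewrite -addnA leq_addr.
pose C' y := if y == y0 then D else C y.
have C'y0 : C' y0 = D by rewrite /C' eqxx.
have sC' y : C' y \subset C y by rewrite /C'; case: eqP => // ->.
have hC' j r y : r \in R :&: chunk n (sigma L0) (beta j) -> y != y0 ->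
    W <= b * n * deg E r (C' y).
  rewrite inE /C' => /andP[rR _] /negPf->; rewrite (leq_trans (hd r y rR)) //.
  by rewrite leq_mul2r leq_mul2r /b leq_addr !orbT.
have hcard : n <= b * #|C' y0|.
  by rewrite C'y0 (leq_trans cD) // leq_mul2r /b leq_addl orbT.
have hdeg j c : c \in C' y0 ->
    W <= b * n * deg (transp E) c (R :&: chunk n (sigma L0) (beta j)).
  rewrite C'y0 => cD'; rewrite (leq_trans (hD c j cD')) //.
  by rewrite leq_mul2r leq_mul2r /b leq_addl !orbT.
have sp1 : sparse_upto sigma E W M1.
  by apply: sparse_upto_le sp; rewrite addnAC leq_addl.
have sp2 : sparse_upto sigma E W M2.
  by apply: sparse_upto_le sp; rewrite leq_addl.
have := hM1 n E W _ C' y0 n0 W0 sp1 (hC' ord0) hcard (hdeg ord0).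
have := hM2 n E W _ C' y0 n0 W0 sp2 (hC' (lift ord0 ord0)) hcard
  (hdeg (lift ord0 ord0)).
set A1 := anchors _ _ _ _ _ _ _; set A2 := anchors _ _ _ _ _ _ _ => h1 h2.
(* Both anchor sets contain more than half of [D], so they meet. *)
have [c] : exists c, c \in A1 :&: A2.
  apply/card_gt0P.
  have : #|A1 :|: A2| <= #|C' y0|.
    by apply: subset_leq_card; apply/subsetP => c; rewrite !inE => /orP[]/andP[].
  rewrite cardsU; have := subset_leq_card (subsetIl A1 A2); lia.
rewrite !inE => /andP[/andP[_ /asboolP[f2 [g2 [emb2 gc2]]]]].
move=> /andP[_ /asboolP[f1 [g1 [emb1 gc1]]]].
suff [f [g fg]] : exists f g, embeds E p u v R C' f g.
  by exists f, g; apply: embeds_sub fg.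
apply: (embeds_glue _ _ _ sep emb1 emb2).
- move=> r1 r2; rewrite !inE => /andP[_ /eqP h1'] /andP[_ /eqP h2'].
  have /forallP/(_ ord0)/forallP/(_ (lift ord0 ord0))/implyP/(_ isT) := inc_beta.
  rewrite -h1' -h2'; apply: contraLR; rewrite -!leqNgt; exact: leq_div2r.
- exact: subsetIl.
- exact: subsetIl.
- by rewrite gc1 gc2.
Qed.

(** Branching the whole matrix over [k] column chunks supplies the initial rich rows; the increasing
    chunks put the columns of the copy in order. *)
Lemma splittable_contained l : 0 < l -> 0 < k -> splittable l p ->
  exists M, forall n (E : rel 'I_n), 0 < wt E setT setT ->
    sparse_upto sigma E (wt E setT setT) M ->
    exists (f : 'I_l -> 'I_n) (g : 'I_k -> 'I_n),
      [/\ increasing f, increasing g & forall (x : 'I_l) y, p x y -> E (f x) (g y)].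
Proof.
move=> l0 k0 spl; pose L0 := 4 * 1 * k.+1; pose a := 4 * 1 * sigma L0 ^ k.+1.
have [M hM] := splittable_embeddable a spl l0 (leqnn l).
exists (L0 + M) => n E W0 sp.
have [||beta [inc_beta [R [_ cR hR]]]] :=
    @branch n E _ (sigma L0) 1 k setT setT W0 (sigma_gt0 _) k0.
- by rewrite mul1n.
- by apply: sp; rewrite leq_addr.
have n0 : 0 < n.
  case: n E W0 {sp R cR hR} => // E.
  by rewrite /wt big1 // => -[].
have [||r y|f [g [inc_f _ gC Efg]]] :=
  hM n E _ R (fun y => setT :&: chunk n (sigma L0) (beta y)) n0 W0.
- by apply: sparse_upto_le sp; rewrite leq_addl.
- exact: cR.
- exact: hR.
exists (fun x : 'I_l => f x), g; split.
- apply/forallP => x; apply/forallP => x'; apply/implyP => xx'.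
  by apply: inc_f.
- apply/forallP => y; apply/forallP => y'; apply/implyP => yy'.
  have /forallP/(_ y)/forallP/(_ y')/implyP/(_ yy') := inc_beta.
  have := gC y; have := gC y'; rewrite !inE /= => /eqP <- /eqP <-.
  apply: contraLR; rewrite -!leqNgt; exact: leq_div2r.
- by move=> x y; apply: Efg; rewrite ltn_ord.
Qed.

End Embed.

(** * From degenerate matrices to a scaling inequality for extremal numbers *)

Definition rowpred (l k : nat) (P : 'M[bool]_(l, k)) (x : nat) (y : 'I_k) : bool :=
  [exists i : 'I_l, (i == x :> nat) && P i y].

Lemma rowpred_ord (l k : nat) (P : 'M[bool]_(l, k)) (i : 'I_l) y :
  rowpred P i y = P i y.
Proof.
apply/existsP/idP => [[j /andP[/eqP/val_inj->]] //|Piy].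
by exists i; rewrite eqxx.
Qed.

(** Degeneracy is applied to the submatrix of rows [u] to [v - 1] with all columns. *)
Lemma degenerate_splittable (l k : nat) (P : 'M[bool]_(l, k)) :
  0 < k -> vertically_degenerate P -> splittable l (rowpred P).
Proof.
move=> k0 degP u v uv vl.
have fP (i : 'I_(v - u)) : u + i < l by have := ltn_ord i; lia.
pose f := [ffun i => Ordinal (fP i)]; pose g : {ffun 'I_k -> 'I_k} := [ffun y => y].
have subQ : submatrix (mxsub f g P) P.
  apply/existsP; exists f; apply/existsP; exists g; rewrite eqxx andbT.
  apply/andP; split; apply/forallP => i; apply/forallP => j; apply/implyP;
    by rewrite !ffunE //= ltn_add2l.
have vu0 : 0 < v - u by lia.
have [|[a [/andP[a0 al]]]] := degP _ _ _ vu0 k0 subQ; first by lia.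
set S := [set _ | _] => cS; exists (u + a).
(* When no column is exceptional, any column may serve as [y0]. *)
have [y0 hy0] : exists y0, forall y, y != y0 -> y \notin S.
  have [->|[y0 y0S]] := set_0Vmem S; first by exists (Ordinal k0) => y; rewrite inE.
  exists y0 => y; apply: contra => yS; apply/eqP.
  by move/card_le1_eqP: cS => /(_ y y0 yS y0S).
exists y0; split=> [|y /hy0]; first by lia.
rewrite inE negbK => /orP[]/forallP H; [left|right] => x xb;
  apply/existsP => -[i /andP[/eqP ix]]; apply/negP.
- have xu : x - u < v - u by lia.
  have /implyP := H (Ordinal xu); rewrite mxE !ffunE /=.
  have -> : Ordinal (fP (Ordinal xu)) = i by apply: val_inj => /=; lia.
  by apply; lia.
- have xu : x - u < v - u by lia.
  have /implyP := H (Ordinal xu); rewrite mxE !ffunE /=.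
  have -> : Ordinal (fP (Ordinal xu)) = i by apply: val_inj => /=; lia.
  by apply; lia.
Qed.

Definition entries (n : nat) (A : 'M[bool]_n) : rel 'I_n := fun r c => A r c.

Lemma weight_sum (m n : nat) (A : 'M[bool]_(m, n)) :
  weight A = \sum_i \sum_j A i j.
Proof.
rewrite /weight pair_big /= -sum1_card [LHS]big_mkcond /=.
by apply: eq_bigr => ij _; rewrite inE; case: (A _ _).
Qed.

Lemma weight_wt (n : nat) (A : 'M[bool]_n) : weight A = wt (entries A) setT setT.
Proof.
rewrite weight_sum /wt /deg; apply: eq_big => [r|r _]; first by rewrite inE.
by apply: eq_bigl => c; rewrite inE.
Qed.

Lemma weight_le (n : nat) (A : 'M[bool]_n) : weight A <= n * n.
Proof. by rewrite (leq_trans (max_card _)) // card_prod !card_ord. Qed.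

Lemma increasing_inj (m n : nat) (f : 'I_m -> 'I_n) : increasing f -> injective f.
Proof.
move=> inc x y fxy; apply: val_inj.
have H (i j : 'I_m) : i < j -> f i < f j.
  by move: inc => /forallP/(_ i)/forallP/(_ j)/implyP.
by case: (ltngtP x y) => // /H; rewrite fxy ltnn.
Qed.

Lemma containsP (l k m n : nat) (A : 'M[bool]_(m, n)) (B : 'M[bool]_(l, k)) :
  reflect (exists f g, [/\ increasing f, increasing g &
             forall x y, B x y -> A (f x) (g y)])
          (contains A B).
Proof.
apply: (iffP existsP) => [[A' /andP[]]|[f [g [incf incg fg]]]].
  move=> /existsP[f /existsP[g /and3P[incf incg /eqP->]]] /forallP H.
  exists f, g; split=> // x y Bxy.
  by have /forallP/(_ y)/implyP/(_ Bxy) := H x; rewrite mxE.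
exists (mxsub f g A); apply/andP; split; last first.
  by apply/forallP => x; apply/forallP => y; apply/implyP => /fg; rewrite mxE.
have incE d e (h : 'I_d -> 'I_e) : increasing [ffun x => h x] = increasing h.
  by apply: eq_forallb => i; apply: eq_forallb => j; rewrite !ffunE.
apply/existsP; exists [ffun x => f x]; apply/existsP; exists [ffun x => g x].
rewrite !incE incf incg; apply/eqP/matrixP => x y; by rewrite !mxE !ffunE.
Qed.

Lemma contains_mxsub (l k m n m' n' : nat) (A : 'M[bool]_(m, n))
    (B : 'M[bool]_(l, k)) (f : 'I_m' -> 'I_m) (g : 'I_n' -> 'I_n) :
  increasing f -> increasing g -> contains (mxsub f g A) B -> contains A B.
Proof.
move=> incf incg /containsP[f' [g' [incf' incg' H]]]; apply/containsP.
have comp d1 d2 d3 (h : 'I_d2 -> 'I_d3) (h' : 'I_d1 -> 'I_d2) :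
    increasing h -> increasing h' -> increasing (h \o h').
  move=> i1 i2; apply/forallP => i; apply/forallP => j; apply/implyP => ij.
  have ij' : h' i < h' j by move: i2 => /forallP/(_ i)/forallP/(_ j)/implyP/(_ ij).
  by move: i1 => /forallP/(_ (h' i))/forallP/(_ (h' j))/implyP/(_ ij').
exists (f \o f'), (g \o g'); split; [exact: comp|exact: comp|].
by move=> x y /H; rewrite mxE.
Qed.

Lemma weight_mxsub (n N : nat) (A : 'M[bool]_n) (f g : 'I_N -> 'I_n) :
  injective f -> injective g ->
  weight (mxsub f g A) = wt (entries A) [set f x | x in setT] [set g y | y in setT].
Proof.
move=> injf injg; rewrite weight_sum /wt big_imset /=; last by move=> x y _ _ /injf.
apply: eq_big => [x|x _]; first by rewrite inE.
rewrite /deg big_imset /=; last by move=> y z _ _ /injg.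
by apply: eq_big => [y|y _]; rewrite ?inE // mxE.
Qed.

Lemma subset_of_card (T : finType) (X : {set T}) (N : nat) :
  #|X| <= N -> N <= #|T| -> exists2 Y : {set T}, X \subset Y & #|Y| = N.
Proof.
move=> XN NT.
have [Z /[!inE] /andP[sZ /eqP cZ]] : exists Z : {set T},
    Z \in [set Z : {set T} | (Z \subset ~: X) && (#|Z| == N - #|X|)].
  apply/card_gt0P; rewrite cards_draws bin_gt0; have := cardsC X; lia.
exists (X :|: Z); first exact: subsetUl.
rewrite cardsU cZ disjoint_setI0 ?cards0; first by lia.
by rewrite disjoint_sym disjoints_subset.
Qed.

Lemma increasing_onto (n N : nat) (X : {set 'I_n}) : #|X| <= N -> N <= n ->
  exists2 f : 'I_N -> 'I_n, increasing f & X \subset [set f x | x in setT].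
Proof.
move=> XN Nn; have [|Y sXY cY] := subset_of_card XN; first by rewrite card_ord.
have [f incf fY] := increasing_enum (eq_leq (esym cY)).
exists f => //; apply: (subset_trans sXY).
have sfY : [set f x | x in setT] \subset Y by apply/subsetP => _ /imsetP[x _ ->].
rewrite -(geq_leqif (subset_leqif_card sfY)) cY card_imset ?cardsT ?card_ord //.
exact: increasing_inj.
Qed.

(** [X] and [Y] are padded to exactly [N] indices; the resulting [N] by [N] submatrix still avoids
    [P]. *)
Lemma wt_extremal (l k n N : nat) (P : 'M[bool]_(l, k)) (A : 'M[bool]_n)
    (X Y : {set 'I_n}) :
  ~~ contains A P -> #|X| <= N -> #|Y| <= N -> N <= n ->
  wt (entries A) X Y <= extremal N P.
Proof.
move=> freeA XN YN Nn.
have [f incf sX] := increasing_onto XN Nn; have [g incg sY] := increasing_onto YN Nn.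
rewrite (leq_trans (wt_subset _ sX sY)) // -weight_mxsub; last 2 first.
- exact: increasing_inj.
- exact: increasing_inj.
apply: (leq_bigmax_cond (F := @weight N N)).
apply: contra freeA; exact: contains_mxsub.
Qed.

Lemma extremal_attained (l k n : nat) (P : 'M[bool]_(l, k)) : 0 < extremal n P ->
  exists2 A : 'M[bool]_n, ~~ contains A P & weight A = extremal n P.
Proof.
move=> e0; have [|A freeA eA] :=
  @eq_bigmax_cond _ [pred A : 'M[bool]_n | ~~ contains A P] (@weight n n).
  apply/card_gt0P; apply/existsP; apply: contraLR e0 => /existsPn none.
  by rewrite /extremal big_pred0 // => A; apply/negbTE; apply: none.
by exists A; [exact: freeA | exact: esym eA].
Qed.

Lemma extremal_le (l k n : nat) (P : 'M[bool]_(l, k)) : extremal n P <= n * n.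
Proof. by apply/bigmax_leqP => A _; apply: weight_le. Qed.

(** A [P]-free matrix of maximum weight cannot be sparse at all scales up to [M]. At a failing scale
    some small submatrix is too heavy, yet it is [P]-free and so bounded by the extremal number of
    its size. *)
Lemma extremal_scale (l k : nat) (P : 'M[bool]_(l, k)) (sigma : nat -> nat) :
  0 < weight P -> vertically_degenerate P -> (forall L, 1 < sigma L) ->
  exists M, forall n, (forall L, L <= M -> sigma L <= n) -> 0 < extremal n P ->
    exists2 L, L <= M &
      extremal n P < L * sigma L * extremal (n %/ sigma L).+1 P.
Proof.
move=> P0 degP sigma1.
have [i [j _]] : exists i j, P i j.
  by move/card_gt0P: P0 => -[[i j]]; rewrite inE => Pij; exists i, j.
have l0 : 0 < l by apply: leq_ltn_trans (ltn_ord i).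
have k0 : 0 < k by apply: leq_ltn_trans (ltn_ord j).
have [M hM] := splittable_contained (fun L => ltnW (sigma1 L)) l0 k0
  (degenerate_splittable k0 degP).
exists M => n sn e0; have [A freeA wA] := extremal_attained e0.
apply: contrapT => H; case/negP: (freeA); apply/containsP.
have [||f [g [incf incg fg]]] := hM n (entries A).
- by rewrite -weight_wt wA.
- move=> L LM X Y hX hY; rewrite -weight_wt wA leqNgt; apply/negP => lt.
  apply: H; exists L => //; rewrite (leq_trans lt) // leq_mul2l; apply/orP; right.
  apply: wt_extremal => //; apply: ltn_Pdiv => //.
  by apply: leq_trans (sn L LM); apply: ltnW.
by exists f, g; split=> // x y Pxy; apply: fg; rewrite rowpred_ord.
Qed.

(* Power bounds and the exponent 1 + o(1) *)
From mathcomp Require Import all_classical all_reals all_analysis.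
From mathcomp Require Import ring lra.
Import Order.TTheory GRing.Theory Num.Theory numFieldNormedType.Exports.

Local Open Scope classical_set_scope.
Local Open Scope ring_scope.

Lemma scale_exists (R : realType) (e : R) (L : nat) : 0 < e ->
  exists s : nat, (2 < s)%N /\ 4 * L%:R <= s%:R `^ e.
Proof.
move=> e0; pose x : R := (4 * L%:R) `^ e^-1; exists (Num.bound x).+3; split=> //.
have L0 : (0 : R) <= 4 * L%:R by rewrite mulr_ge0.
have -> : 4 * L%:R = x `^ e by rewrite /x -powRrM mulVf ?gt_eqF // powRr1.
apply: ge0_ler_powR; rewrite ?nnegrE ?powR_ge0 ?ler0n ?(ltW e0) //.
have xb : x < (Num.bound x)%:R := archi_boundP (powR_ge0 _ _).
by rewrite (le_trans (ltW xb)) // ler_nat; do 3!apply: leqW.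
Qed.

Lemma extremal_bound (R : realType) (l k : nat) (P : 'M[bool]_(l, k)) (e : R) :
  (0 < weight P)%N -> vertically_degenerate P -> 0 < e <= 1 ->
  exists2 C : R, 0 < C &
    forall n, (0 < n)%N -> (extremal n P)%:R <= C * n%:R `^ (1 + e).
Proof.
move=> P0 degP /andP[e0 e1].
have /choice[sigma hsigma] := fun L => scale_exists L e0.
have sigma2 L : (2 < sigma L)%N by have [] := hsigma L.
have sigma1 L : (1 < sigma L)%N := ltnW (sigma2 L).
have [M hM] := extremal_scale P0 degP sigma1.
pose N := (\max_(L < M.+1) sigma L)%N.
have sigmaN L : (L <= M)%N -> (sigma L <= N)%N.
  by rewrite -ltnS => LM; apply: (leq_bigmax (Ordinal LM)).
(* The trivial bound [n * n] settles every [n < N]; the successor keeps [C] positive. *)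
pose C : R := (N * N).+1%:R; exists C => // n; have [m] := ubnP n.
elim: m n => // m IH n nm n0.
have n1 : 1 <= n%:R `^ (1 + e) :> R.
  apply: (@le_trans _ _ (1 `^ (1 + e))); first by rewrite powR1.
  by rewrite ge0_ler_powR ?nnegrE ?ler1n //; lra.
have [nN|Nn] := ltnP n N.
  rewrite -[leLHS]mulr1 ler_pM // ler_nat (leq_trans (extremal_le _ _)) //.
  by rewrite leqW // leq_mul // ltnW.
rewrite leNgt; apply/negP => big.
have ext0 : (0 < extremal n P)%N.
  by rewrite -(ltr_nat R) (le_lt_trans _ big) // mulr_ge0 ?powR_ge0.
have [L LM] := hM n (fun L LM => leq_trans (sigmaN L LM) Nn) ext0.
apply/negP; rewrite -leqNgt -(ler_nat R) (le_trans _ (ltW big)) // !natrM.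
have sn := leq_trans (sigmaN L LM) Nn.
set s := sigma L in sn *; set h := (n %/ s).+1.
have s2 : (2 < s)%N := sigma2 L.
(* Scales above 2 make the induction descend: [n %/ 3 + 1 < n] once [n >= 3]. *)
have hn : (h < n)%N.
  have := leq_div2l n (isT : 0 < 3)%N s2; rewrite /h; lia.
have hs : (h * s <= 2 * n)%N.
  by rewrite /h mulSn; have := leq_trunc_div n s; lia.
rewrite (le_trans (ler_wpM2l _ (IH h _ _))) ?mulr_ge0 //; first by lia.
rewrite mulrCA ler_wpM2l ?ler0n //.
have s0 : (s != 0)%N by lia.
have se : 4 * L%:R <= s%:R `^ e by have [] := hsigma L.
(* As [h * s <= 2 * n] and [e <= 1], rounding costs a factor of at most [2 ^ 2], which the 4 in
   [scale_exists] absorbs. *)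
have hq : h%:R `^ (1 + e) * (s%:R * s%:R `^ e) <= 4 * n%:R `^ (1 + e) :> R.
  rewrite -{1}[s%:R]powRr1 // -powRD ?pnatr_eq0 ?s0 ?implybT // -powRM //.
  rewrite -natrM (@le_trans _ _ ((2 * n)%:R `^ (1 + e))) //.
    by rewrite ge0_ler_powR ?nnegrE ?ler_nat //; lra.
  rewrite natrM powRM // ler_wpM2r ?powR_ge0 //.
  rewrite (@le_trans _ _ (2 `^ 2)) //; first by rewrite ler_powR ?ler1n //; lra.
  by rewrite powR_mulrn // -natrX.
rewrite -(ler_pM2l (_ : 0 < 4 :> R)) // (le_trans _ hq) //.
have -> : 4 * (L%:R * s%:R * h%:R `^ (1 + e)) =
    h%:R `^ (1 + e) * (s%:R * (4 * L%:R)) :> R by ring.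
by rewrite ler_wpM2l ?powR_ge0 // ler_wpM2l.
Qed.

Theorem theorem1 (R : realType) (l k : nat) (P : 'M[bool]_(l, k))
    (P_nonzero : (0 < weight P)%N) (P_degenerate : vertically_degenerate P) :
  exists eps : nat -> R,
    eps n @[n --> \oo] --> (0 : R) /\
    forall n : nat, (extremal n P)%:R <= n%:R `^ (1 + eps n).
Proof.
(* For [n > 1] and a positive extremal number, [1 + x n] is the exact exponent; the maximum with 0
   leaves only an upper bound to prove for the limit. *)
pose x n : R := ln (extremal n P)%:R / ln n%:R - 1.
exists (fun n => if (n <= 1)%N then 0 else Num.max 0 (x n)); split; last first.
  move=> n; case: leqP => n1.
    have := extremal_le n P; rewrite addr0 powRr1 ?ler0n // ler_nat.
    by case: n n1 => [|[|]].
  have lnn0 : 0 < ln n%:R :> R by rewrite ln_gt0 // ltr1n.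
  have [->|ext0] := posnP (extremal n P); first by rewrite powR_ge0.
  rewrite /powR pnatr_eq0 gtn_eqF ?(ltnW n1) //.
  rewrite -[leLHS]lnK ?posrE ?ltr0n // ler_expR -ler_pdivrMr //.
  by rewrite -lerBlDl le_max lexx orbT.
apply/cvgrPdist_le => e e0.
(* Half of [e] goes to the exponent and half to absorbing [ln C]; the cap 1 meets the range of
   [extremal_bound]. *)
pose d : R := Num.min (e / 2) 1.
have [|C C0 hC] := @extremal_bound R l k P d P_nonzero P_degenerate.
  by rewrite /d lt_min ge_min lexx orbT andbT ltr01 andbT divr_gt0.
have de : d <= e / 2 by rewrite /d ge_min lexx.
near=> n.
have n1 : (1 < n)%N by near: n; apply: nbhs_infty_gt.
have lnn0 : 0 < ln n%:R :> R by rewrite ln_gt0 // ltr1n.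
have lnC : ln C <= e / 2 * ln n%:R.
  rewrite mulrC -ler_pdivrMr ?divr_gt0 // -ler_expR lnK ?posrE ?ltr0n ?(ltnW n1) //.
  by near: n; apply: nbhs_infty_ger.
rewrite leqNgt n1 /= sub0r normrN ger0_norm ?le_max ?lexx // ge_max (ltW e0) /=.
have [ext0|ext0] := posnP (extremal n P).
  (* By convention [ln 0 = 0], so [x n = -1]. *)
  by rewrite /x ext0 ln0 ?mul0r; lra.
rewrite /x lerBlDr ler_pdivrMr //.
have := hC n (ltnW n1).
rewrite -ler_ln ?posrE ?ltr0n ?mulr_gt0 ?powR_gt0 ?ltr0n ?(ltnW n1) //.
rewrite lnM ?posrE ?powR_gt0 ?ltr0n ?(ltnW n1) // ln_powR => h.
apply: (le_trans h); rewrite !mulrDl mul1r.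
have : d * ln n%:R <= e / 2 * ln n%:R by rewrite ler_pM2r.
lra.
Unshelve. all: by end_near.
Qed.
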